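(* For $d=4$ and $k=3$ we have $S(4,3)=11$, and any solvable puzzle in $puz[4,3,11]$ can be solved in at most $17$ moves, i.e. any two configurations lying in the same connected component of $puz[4,3,11]$ are at graph distance at most $17$. Furthermore, the strong parity property holds for $puz[4,3,S(4,3)]$.
   Context: Let $d\ge 1$, $1\le k\le d$, $1\le l\le 2^d$ be integers. $Q^d$ is the graph of vertices and edges of the $d$-dimensional cube, with vertex set $\{0,1\}^d$. A $k$-dimensional face ($k$-face) of $Q^d$ is a set of $2^k$ vertices obtained by fixing $d-k$ of the coordinates. $\mathcal{C}[d,l]$ is the set of all configurations of $2^d-l$ tokens, labeled $1,\dots,2^d-l$, placed on distinct vertices of $Q^d$ (so $l$ vertices are unoccupied). For a configuration $C$, $\mathcal L_C=\{1,\dots,2^d-l\}$ is its set of labels (tokens). Moves: if a token $t$ sits at a vertex of a $k$-face $\sigma$ and all remaining vertices of $\sigma$ are unoccupied, then $t$ can be moved to any other vertex of $\sigma$; this is called a $k$-move. The puzzle graph $puz[d,k,l]$ has vertex set $\mathcal{C}[d,l]$, with $C$ and $D$ joined by an edge when one is reached from the other by a single $k$-move. A puzzle is a pair consisting of an initial and a target configuration; it is solvable if both lie in the same connected component. A configuration $C$ is $k$-isolated if no token can perform a $k$-move; it is $k$-semi-isolated if there is a non-empty proper subset $\mathcal A_C\subsetneq\mathcal L_C$ such that every configuration in the connected component of $C$ in $puz[d,k,l]$ is obtained from $C$ by a series of $k$-moves affecting only tokens in $\mathcal L_C\setminus\mathcal A_C$; it is $k$-mobile if it is neither $k$-isolated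 nor $k$-semi-isolated. $puz[d,k,l]$ has the strong parity property if it has exactly two connected components containing $k$-mobile configurations. A configuration is obtained from $C$ by a permutation $g$ if it has the same occupied vertices and the labels are permuted by $g$. $puz[d,k,l]$ has the even solvability property if there is a configuration $C\in\mathcal C[d,l]$ such that all configurations obtained from $C$ by an even permutation of the labels lie in the same connected component of $puz[d,k,l]$ as $C$. $S(d,k)$ is the minimum integer $l$ such that $puz[d,k,l]$ has the even solvability property. *)

(* Defs.v *)
From HB Require Import structures.
From mathcomp Require Import all_boot all_fingroup.

Set Implicit Arguments.
Unset Strict Implicit.
Unset Printing Implicit Defensive.

Definition vertex (d : nat) := {ffun 'I_d -> bool}.

Definition is_face (d k : nat) (s : {set vertex d}) : bool :=
  [exists F : {set 'I_d}, [exists a : vertex d,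
    (#|F| == d - k) && (s == [set v : vertex d | [forall i in F, v i == a i]])]].

(* The tokens are numbered from 0 instead of 1. *)
Definition label (d l : nat) := 'I_(2 ^ d - l).

Record config (d l : nat) := Config {
  place :> {ffun label d l -> vertex d};
  _ : injectiveb place }.

HB.instance Definition _ (d l : nat) := [isSub for @place d l].
HB.instance Definition _ (d l : nat) := [Finite of config d l by <:].

Section Puzzle.

Variables (d k l : nat).
Implicit Types (C D : config d l) (t : label d l).

Definition occupied C (v : vertex d) : bool := [exists t, C t == v].

Definition token_move t C D : bool :=
  [exists s : {set vertex d},
    [&& is_face k s,
        C t \in s,
        [forall v in s, (v != C t) ==> ~~ occupied C v],
        D t \in s,
        D t != C t &
        [forall t' : label d l, (t' != t) ==> (D t' == C t')]]].

Definition kmove C D : bool := [exists t : label d l, token_move t C D].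

Definition puz : rel (config d l) := fun C D => kmove C D || kmove D C.

Definition component C : {set config d l} := [set D | connect puz C D].

Definition components : {set {set config d l}} :=
  [set component C | C : config d l].

Definition isolated C : bool :=
  ~~ [exists t : label d l, [exists D : config d l, token_move t C D]].

Definition move_outside (A : {set label d l}) : rel (config d l) :=
  fun C D => [exists t in ~: A, token_move t C D].

Definition semi_isolated C : bool :=
  [exists A : {set label d l},
    [&& A != set0,
        A \proper [set: label d l] &
        [forall D in component C, connect (move_outside A) C D]]].

Definition mobile C : bool := ~~ isolated C && ~~ semi_isolated C.

Definition strong_parity : bool :=
  #|[set K in components | [exists C in K, mobile C]]| == 2.

Definition permuted (g : {perm label d l}) C D : bool :=
  [forall t : label d l, D t == C (g t)].

Definition even_solvability : bool :=
  [exists C : config d l, [forall g : {perm label d l}, [forall D : config d l,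
    ~~ odd_perm g ==> permuted g C D ==> connect puz C D]]].

End Puzzle.

Arguments puz {d} k {l}.
Arguments component {d} k {l}.

(* For l = 2 ^ d there are no tokens, hence a single configuration. *)
Lemma even_solvability_ex (d k : nat) :
  exists l, (1 <= l <= 2 ^ d) && even_solvability d k l.
Proof.
exists (2 ^ d); rewrite expn_gt0 leqnn /=.
have no_token (t : label d (2 ^ d)) : False.
  by case: t => m; rewrite subnn.
have inj_f : injectiveb [ffun _ : label d (2 ^ d) => [ffun=> false] : vertex d].
  by apply/injectiveP => t; case: (no_token t).
apply/existsP; exists (Config inj_f).
apply/forallP => g; apply/forallP => D; apply/implyP => _; apply/implyP => _.
suff -> : D = Config inj_f by apply: connect0.
by apply/val_inj/ffunP => t; case: (no_token t).
Qed.

(* S(d, k): the least l in [1, 2 ^ d] with the even solvability property. *)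
Definition minS (d k : nat) : nat := ex_minn (even_solvability_ex d k).

(* Main.v *)
Require Import Defs.
From mathcomp Require Import all_boot all_fingroup.

(** A token can move iff it is alone in one of the 8 facets x_i = b.  Call a set
of tokens frozen if no facet contains exactly one of them: frozen tokens never
move.  With at least 6 tokens every configuration has a nonempty frozen set, and
a 3-cycle of labels moving a frozen token leaves the component; hence
S(4,3) >= 11.

With 5 tokens, a configuration either has at least 4 frozen tokens, and then it
is not mobile and at most one token moves inside its component; or it is active,
i.e. two different tokens can be moved.  The configurations that differ by moving
one token inside one facet form a clique of the puzzle graph, and it suffices to
bound by 16 the distance between cliques.  Up to the symmetries of the cube and
of the labels there are three cliques of active configurations, according to the
shape of the four other tokens, and a breadth-first search from each of them
settles the distance bound.  The first search also shows that every relabelling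
(x y)(0 1), hence every even one, preserves the component of a base
configuration, that every symmetry of the cube maps this component to itself or
to its image under (0 1), and that this image is a different component; this
gives even solvability and exactly two mobile components. *)

Set Implicit Arguments.
Unset Strict Implicit.
Unset Printing Implicit Defensive.

(** * Breadth-first search *)

(** Finite sets of bit strings; a lookup costs no more than the length of the key. *)
Inductive trie := Leaf | Node of bool & trie & trie.

Fixpoint tmem (k : seq bool) (tr : trie) : bool :=
  match tr, k with
  | Leaf, _ => false
  | Node b _ _, [::] => b
  | Node _ l r, c :: k' => tmem k' (if c then r else l)
  end.

Fixpoint tadd (k : seq bool) (tr : trie) : trie :=
  match k, tr with
  | [::], Leaf => Node true Leaf Leaf
  | [::], Node _ l r => Node true l r
  | c :: k', Leaf =>
    if c then Node false Leaf (tadd k' Leaf) else Node false (tadd k' Leaf) Leaf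
  | c :: k', Node b l r =>
    if c then Node b l (tadd k' r) else Node b (tadd k' l) r
  end.

Lemma tmem_leaf k : tmem k Leaf = false.
Proof. by case: k. Qed.

Lemma tmem_add k k' tr : tmem k (tadd k' tr) = (k == k') || tmem k tr.
Proof.
by elim: k' k tr => [|[] k' IHk] [|[] k] [|b l r] //=; rewrite ?IHk ?tmem_leaf.
Qed.

Section BreadthFirstSearch.

Variables (T : eqType) (nbr : T -> seq T) (key : T -> seq bool).
Hypothesis key_inj : injective key.

Fixpoint visit (ys : seq T) (fr : seq T) (tr : trie) : seq T * trie :=
  if ys is y :: ys' then
    if tmem (key y) tr then visit ys' fr tr
    else visit ys' (y :: fr) (tadd (key y) tr)
  else (fr, tr).

Fixpoint bfs (n : nat) (fr : seq T) (tr : trie) : seq T * trie :=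
  if n is n'.+1 then
    let (fr', tr') := visit (flatten (map nbr fr)) [::] tr in bfs n' fr' tr'
  else (fr, tr).

Definition search (n : nat) (x : T) := bfs n [:: x] (tadd (key x) Leaf).

(** Only the last frontier needs inspection: earlier elements had their neighbours inserted when
    they were expanded. *)
Definition saturated (frtr : seq T * trie) : bool :=
  all (fun x => all (fun y => tmem (key y) frtr.2) (nbr x)) frtr.1.

Definition reach (n : nat) (x y : T) : Prop :=
  exists p, [/\ path (fun a b => b \in nbr a) x p, last x p = y & size p <= n].

Lemma visitP ys fr tr : exists fr',
  [/\ (visit ys fr tr).1 = fr' ++ fr,
      forall k, tmem k (visit ys fr tr).2 = tmem k tr || (k \in map key fr'),
      {subset fr' <= ys}
    & forall y, y \in ys -> tmem (key y) (visit ys fr tr).2].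
Proof.
elim: ys fr tr => [|y ys IHys] fr tr /=.
  by exists [::]; split=> // k; rewrite orbF.
case: ifPn => [y_tr | y_tr].
  have [fr' [-> tr'E sub mem]] := IHys fr tr; exists fr'; split=> // x.
    by move/sub; rewrite inE orbC => ->.
  by rewrite inE => /predU1P[->|/mem//]; rewrite tr'E y_tr.
have [fr' [-> tr'E sub mem]] := IHys (y :: fr) (tadd (key y) tr).
exists (rcons fr' y); split=> [|k|x|x].
- by rewrite cat_rcons.
- by rewrite tr'E tmem_add map_rcons mem_rcons inE orbCA orbA.
- by rewrite mem_rcons !inE => /predU1P[->|/sub->]; rewrite ?eqxx ?orbT.
- by rewrite inE => /predU1P[->|/mem//]; rewrite tr'E tmem_add eqxx.
Qed.

(** Loop invariant: the trie holds only elements within reach of [x], and only those of the frontier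
    may have neighbours outside it. [m] counts the rounds already made. *)
Lemma bfsP m x n fr tr :
    (forall y, tmem (key y) tr -> reach m x y) ->
    (forall y, y \in fr -> tmem (key y) tr) ->
    (forall y z, tmem (key y) tr -> y \notin fr -> z \in nbr y ->
      tmem (key z) tr) ->
  let: (fr', tr') := bfs n fr tr in
  [/\ forall y, tmem (key y) tr -> tmem (key y) tr',
      forall y, tmem (key y) tr' -> reach (m + n) x y
    & forall y z, tmem (key y) tr' -> y \notin fr' -> z \in nbr y ->
        tmem (key z) tr'].
Proof.
elim: n m fr tr => [|n IHn] m fr tr reach_tr fr_tr done_tr /=.
  by rewrite addn0; split.
have [fr' []] := visitP (flatten (map nbr fr)) [::] tr.
case: visit => _ tr' /= -> tr'E sub mem; rewrite cats0.
have /(_ m.+1) := IHn _ fr' tr'; case: bfs => fr2 tr2 /=.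
rewrite addSnnS; case=> [y|y|y z|sub2 r2 d2].
- rewrite tr'E => /orP[/reach_tr[p [? ? le_p]]|]; first by exists p; split=> //;
  exact: leqW.
  rewrite mem_map // => /sub/flatten_mapP[a].
  move=> /fr_tr/reach_tr[p [a_p a_l le_p]] y_a.
  exists (rcons p y); rewrite rcons_path last_rcons size_rcons a_p.
  by rewrite a_l; split.
- by move=> y_fr'; rewrite tr'E map_f ?orbT.
- rewrite tr'E mem_map // => /orP[y_tr _ z_y|-> //].
  have [y_fr|/done_tr] := boolP (y \in fr); last by rewrite tr'E => -> //.
  by apply/mem/flatten_mapP; exists y.
by split=> // y y_tr; apply: sub2; rewrite tr'E y_tr.
Qed.

(** A saturated trie therefore describes exactly what is reachable from [x], all of it within [n]
    steps. *)
Lemma searchP n x :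
  [/\ forall y, tmem (key y) (search n x).2 -> reach n x y,
      tmem (key x) (search n x).2
    & saturated (search n x) -> forall y z, tmem (key y) (search n x).2 ->
        z \in nbr y -> tmem (key z) (search n x).2].
Proof.
have := @bfsP 0 x n [:: x] (tadd (key x) Leaf); rewrite -/(search n x).
have memE y : tmem (key y) (tadd (key x) Leaf) = (y == x).
  by rewrite tmem_add tmem_leaf orbF (inj_eq key_inj).
case: search => fr tr /=; case=> [y|y|y z|sub r d].
- by rewrite memE => /eqP->; exists [::].
- by rewrite memE inE.
- by rewrite memE inE => ->.
split=> //; first by apply: sub; rewrite memE.
move=> /allP sat y z y_tr z_y; have [/sat/allP-> //|] := boolP (y \in fr).
by move=> y_fr; apply: d y_tr y_fr z_y.
Qed.

End BreadthFirstSearch.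

(** * Moves inside facets *)

Section FacetMoves.

Variable l : nat.
Implicit Types (C D E : config 4 l) (t u : label 4 l) (i j : 'I_4)
  (P : {set label 4 l}).

Definition alone C t i : bool := [forall u, (u != t) ==> (C u i != C t i)].

(** Unlike a move, a slide may leave [t] in place. For fixed [t] and [i] this gives an equivalence
    on the configurations with [t] alone; its classes are the cliques. *)
Definition slide t i C D : bool :=
  [&& alone C t i, D t i == C t i & [forall u, (u != t) ==> (D u == C u)]].

Lemma aloneP C t i : reflect (forall u, u != t -> C u i = ~~ C t i) (alone C t i).
Proof.
apply: (iffP forallP) => H u; last first.
  by apply/implyP => /H ->; case: (C t i).
by move=> /(implyP (H u)); case: (C u i); case: (C t i).
Qed.

Lemma slideP t i C D :
  reflect [/\ alone C t i, D t i = C t i & forall u, u != t -> D u = C u]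
    (slide t i C D).
Proof.
apply: (iffP and3P) => -[aC /eqP Dt H]; split=> //; try exact/eqP.
  by move=> u u_t; apply/eqP/(implyP (forallP H u)).
by apply/forallP=> u; apply/implyP => /H->.
Qed.

Lemma config_inj C : injective C.
Proof. by case: C => f /= /injectiveP. Qed.

Lemma config_eq C D : (forall t, C t = D t) -> C = D.
Proof. by move=> H; apply/val_inj/ffunP. Qed.

Lemma slide_refl t i C : alone C t i -> slide t i C C.
Proof. by move=> aC; apply/slideP. Qed.

Lemma alone_slide t i C D : slide t i C D -> alone D t i.
Proof.
case/slideP => /aloneP aC Dt H; apply/aloneP => u u_t.
by rewrite H // Dt aC.
Qed.

Lemma slide_sym t i C D : slide t i C D -> slide t i D C.
Proof.
move=> s; have aD := alone_slide s; case/slideP: s => _ Dt H.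
by apply/slideP; split=> // u /H.
Qed.

Lemma facetP (s : {set vertex 4}) :
  reflect (exists i b, s = [set v : vertex 4 | v i == b]) (is_face 3 s).
Proof.
apply: (iffP existsP) => [[F /existsP[a /andP[/cards1P[i ->] /eqP->]]]|[i [b ->]]].
  exists i, (a i); apply/setP => v; rewrite !inE;
    apply/forallP/idP => [/(_ i)|vi j].
    by rewrite inE eqxx.
  by rewrite inE; apply/implyP => /eqP->.
exists [set i]; apply/existsP; exists [ffun=> b]; rewrite cards1 /=.
apply/eqP/setP => v; rewrite !inE; apply/idP/forallP => [vi j|/(_ i)].
  by rewrite inE; apply/implyP => /eqP->; rewrite ffunE.
by rewrite inE eqxx ffunE.
Qed.

Lemma token_moveP t C D :
  reflect (exists2 i, slide t i C D & D t != C t) (token_move 3 t C D).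
Proof.
apply: (iffP existsP) =>
  [[s /and5P[/facetP[i [b ->]]]]|[i /slideP[/aloneP aC Dt H] DnC]].
  rewrite !inE => /eqP Ct /forallP Cfree /eqP Dt /andP[DnC H].
  exists i => //; apply/and3P; split=> //; last by rewrite Ct Dt.
  apply/forallP => u; apply/implyP => u_t; apply/negP => /eqP Cu.
  have := Cfree (C u); rewrite inE Cu Ct eqxx (inj_eq (@config_inj C)) u_t /=.
  by move/negP; apply; apply/existsP; exists u.
exists [set v : vertex 4 | v i == C t i]; apply/and5P; split.
- by apply/facetP; exists i, (C t i).
- by rewrite inE.
- apply/forallP => v; apply/implyP; rewrite inE => vi; apply/implyP => vC.
  apply/existsP => -[u /eqP uv]; have [ut|/aC] := eqVneq u t.
    by rewrite -uv ut eqxx in vC.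
  by rewrite uv (eqP vi); case: (C t i).
- by rewrite inE Dt.
- by rewrite DnC; apply/forallP => u; apply/implyP => /H->.
Qed.

Lemma puzP C D : reflect (exists t i, slide t i C D /\ D t != C t) (puz 3 C D).
Proof.
apply: (iffP orP) => [[/existsP[t]|/existsP[t]]|[t [i [s DnC]]]].
- by case/token_moveP => i ? ?; exists t, i.
- by case/token_moveP => i /slide_sym ? ?; exists t, i; rewrite eq_sym.
by left; apply/existsP; exists t; apply/token_moveP; exists i.
Qed.

Lemma puz_sym : symmetric (@puz 4 3 l).
Proof. by move=> C D; rewrite /puz orbC. Qed.

Lemma connect_puz_sym : connect_sym (@puz 4 3 l).
Proof. exact/sym_connect_sym/puz_sym. Qed.

Lemma slide_puz t i C D : slide t i C D -> C = D \/ puz 3 C D.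
Proof.
move=> s; have [Dt|Dt] := eqVneq (D t) (C t); last by right; apply/puzP;
  exists t, i.
left; apply: config_eq => u; case/slideP: s => _ _ H.
by have [->|/H->] := eqVneq u t.
Qed.

Lemma slide_connect t i C D : slide t i C D -> connect (puz 3) C D.
Proof. by case/slide_puz => [->|/connect1]. Qed.

(** No other token lies in the facet, so [t] may be put anywhere in it without a collision. *)
Lemma moveE C t i (v : vertex 4) : alone C t i -> v i = C t i ->
  exists2 D, slide t i C D & D t = v.
Proof.
move=> aC vi; have aCP := aloneP _ _ _ aC.
have inj_f : injectiveb [ffun u => if u == t then v else C u].
  apply/injectiveP => x y; rewrite !ffunE.
  case: eqVneq => [->|x_t]; case: eqVneq => [->|y_t] //.
  - by move=> vy; have := aCP y y_t; rewrite -vy vi; case: (C t i).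
  - by move=> vx; have := aCP x x_t; rewrite vx vi; case: (C t i).
  exact: config_inj.
exists (Config inj_f); last by rewrite ffunE eqxx.
by apply/slideP; split=> //= [|u /negPf u_t]; rewrite ffunE ?eqxx ?u_t.
Qed.

Definition frozen P C : bool :=
  [forall t in P, [forall i, [exists u in P, (u != t) && (C u i == C t i)]]].

Lemma frozenP P C :
  reflect (forall t i, t \in P -> exists2 u, u \in P & u != t /\ C u i = C t i)
    (frozen P C).
Proof.
apply: (iffP forall_inP) =>
  [H t i /H/forallP/(_ i)/exists_inP[u uP /andP[? /eqP]]|H t tP].
  by exists u.
apply/forallP => i; apply/exists_inP; have [u uP [? ?]] := H t i tP.
by exists u => //; apply/andP; split=> //; apply/eqP.
Qed.

Lemma frozen_eq P C D : (forall t, t \in P -> D t = C t) -> frozen P C ->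
  frozen P D.
Proof.
move=> H /frozenP fr; apply/frozenP => t i tP; have [u uP [? E]] := fr t i tP.
by exists u; rewrite ?H.
Qed.

(** A sliding token is alone in a facet, whereas every facet through a token of [P] contains a
    second one. *)
Lemma frozen_slide P C t i D : frozen P C -> slide t i C D -> t \notin P.
Proof.
move=> /frozenP fr /slideP[/aloneP aC _ _]; apply/negP => /(fr t i)[u _ [/aC -> ]].
by case: (C t i).
Qed.

Lemma frozen_connect P C D :
  frozen P C -> connect (puz 3) C D -> forall t, t \in P -> D t = C t.
Proof.
move=> fr /connectP[p p_path ->]; elim: p C fr p_path => [|E p IHp] C fr //=.
case/andP=> /puzP[u [i [s _]]] p_path t tP.
have EC x : x \in P -> E x = C x.
  case/slideP: (s) => _ _ H xP; apply: H.
  by apply: contraTneq xP => ->; apply: frozen_slide fr s.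
by rewrite IHp ?EC //; apply: frozen_eq fr.
Qed.

Lemma frozen_comp P C D : frozen P C -> connect (puz 3) C D -> frozen P D.
Proof. by move=> fr /(frozen_connect fr) CD; apply: frozen_eq fr. Qed.

(** Four tokens on a square fill it, and a facet that meets a square contains at least two of its
    vertices. *)
Lemma square_frozen P C i j b c :
    i != j -> 3 < #|P| ->
    (forall x, x \in P -> C x i = b) -> (forall x, x \in P -> C x j = c) ->
  frozen P C.
Proof.
move=> ij P4 Pi Pj; apply/frozenP => x k xP.
pose Q := P :\ x; have Q3 : 2 < #|Q| by rewrite (cardsD1 x) xP in P4.
have QP y : y \in Q -> y \in P by case/setD1P.
have [/exists_inP[y /setD1P[yx yP] /eqP yk]|] :=
  boolP [exists y in Q, C y k == C x k].
  by exists y.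
rewrite negb_exists_in => /forall_inP Qk.
have Qk' y : y \in Q -> C y k = ~~ C x k.
  by move/Qk; case: (C y k); case: (C x k).
have [y yQ] : exists y, y \in Q by apply/card_gt0P; apply: leq_trans Q3.
have [ki|ki] := eqVneq k i.
  by have := Qk' y yQ; rewrite ki !Pi ?(QP y) //; case: (b).
have [kj|kj] := eqVneq k j.
  by have := Qk' y yQ; rewrite kj !Pj ?(QP y) //; case: (c).
have /cards1P[m mE] : #|~: [set k; i; j]| == 1.
  have := cardsC [set k; i; j]; rewrite card_ord -setUA cardsU1 cards2 !inE.
  by rewrite (negPf ki) (negPf kj) ij /= => /eqP.
(* The three or more tokens of [Q] agree in the coordinates [i], [j] and [k], so the remaining
   coordinate [m] would separate them. *)
suff : #|Q| <= #|{: bool}| by rewrite card_bool leqNgt Q3.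
apply: (@leq_card_in _ _ (fun y => C y m)) => y1 y2 Q1 Q2 E.
apply: (@config_inj C); apply/ffunP => z.
have [->|zk] := eqVneq z k; first by rewrite (Qk' y1) ?(Qk' y2).
have [->|zi] := eqVneq z i; first by rewrite (Pi y1) ?(Pi y2) ?QP.
have [->|zj] := eqVneq z j; first by rewrite (Pj y1) ?(Pj y2) ?QP.
have : z \in ~: [set k; i; j] by rewrite !inE (negPf zk) (negPf zi) (negPf zj).
by rewrite mE inE => /eqP->.
Qed.

(* If i != j, then t can step to the half of its facet outside x_j = C u j,
   which leaves u alone in that facet. *)
Definition active t i u j C : bool :=
  [&& u != t, alone C t i & [forall x, (x != t) && (x != u) ==> (C x j != C u j)]].

Lemma activeP t i u j C :
  reflect [/\ u != t, alone C t i &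
             forall x, x != t -> x != u -> C x j = ~~ C u j]
    (active t i u j C).
Proof.
apply: (iffP and3P) => -[ut aC H]; split=> //.
  by move=> x xt xu; move/forallP: H => /(_ x); rewrite xt xu /=; case: (C x j);
    case: (C u j).
apply/forallP => x; apply/implyP => /andP[xt xu].
by rewrite H //; case: (C u j).
Qed.

(** If no token is alone, all are frozen. If [t] is alone and the others are not frozen, some [u] is
    the only one of these others in a facet. *)
Lemma frozen_or_active C :
  (exists2 P, frozen P C & #|~: P| <= 1) \/ (exists t i u j, active t i u j C).
Proof.
have [/existsP[t /existsP[i aC]]|none] := boolP [exists t, [exists i, alone C t i]].
  have [fr|/frozenP nfr] := boolP (frozen (~: [set t]) C).
    by left; exists (~: [set t]); rewrite // setCK cards1.
  right; have [/existsP[u /existsP[j act]]|] :=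
    boolP [exists u, [exists j, active t i u j C]].
    by exists t, i, u, j.
  move=> nact; case: nfr => u j; rewrite !inE => ut.
  have : ~~ active t i u j C.
    by apply: contra nact => ?; apply/existsP; exists u; apply/existsP; exists j.
  rewrite /active ut aC /= => /forallPn[x]; rewrite negb_imply negbK.
  by case/andP=> /andP[xt xu] /eqP E; exists x; rewrite ?inE.
left; exists setT; last by rewrite setCT cards0.
apply/frozenP => t i _; have : ~~ alone C t i.
  by apply: contra none => ?; apply/existsP; exists t; apply/existsP; exists i.
by case/forallPn => u; rewrite negb_imply negbK => /andP[ut /eqP]; exists u.
Qed.

(** If [i = j], a third token would differ from both [t] and [u] in a coordinate where these two
    differ. *)
Lemma active_coord t i u j C : active t i u j C -> 2 < #|label 4 l| -> i != j.
Proof.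
case/activeP => ut /aloneP aC Hu n3; apply: contraTneq n3 => ij.
suff : #|[set: label 4 l]| <= #|[set t;
  u]| by rewrite cardsT cards2 -leqNgt eq_sym ut.
apply/subset_leq_card/subsetP => x _; rewrite !inE.
have [//|xt] := eqVneq x t; have [//|xu] := eqVneq x u.
by have := Hu x xt xu; rewrite -ij (aC x) ?(aC u) //; case: (C t i).
Qed.

Lemma active_slide t i u j C : active t i u j C -> i != j ->
  exists2 D, slide t i C D & alone D u j.
Proof.
case/activeP => ut aC Hu ij.
have := @moveE C t i [ffun k => if k == i then C t i else ~~ C u j] aC.
rewrite !ffunE eqxx => /(_ erefl)[D s Dt]; exists D => //; apply/aloneP => x xu.
case/slideP: s => _ _ H; rewrite (H u) //.
have [->|xt] := eqVneq x t; last by rewrite H // Hu.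
by rewrite Dt ffunE [j == i]eq_sym (negPf ij).
Qed.

Lemma alone_moves C t i : alone C t i ->
  exists2 D, connect (puz 3) C D & D t != C t.
Proof.
move=> aC; have [j ji] : exists j, j != i.
  by exists (if i == ord0 then ord_max else ord0);
    case: (eqVneq i ord0) => [->|]; rewrite // eq_sym.
(* The target is the antipode of [C t] within the facet. *)
have := @moveE C t i [ffun k => if k == i then C t i else ~~ C t k] aC.
rewrite ffunE eqxx => /(_ erefl)[D s Dt]; exists D; first exact: slide_connect s.
apply/eqP => /ffunP/(_ j); rewrite Dt ffunE (negPf ji).
by case: (C t j).
Qed.

(** Both [t] and [u] move somewhere in the component, and at least one of them is not [x]. *)
Lemma active_not_frozen t i u j C x : active t i u j C -> i != j ->
  ~~ frozen (~: [set x]) C.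
Proof.
move=> act ij; apply/negP => fr; have [ut aC _] := activeP _ _ _ _ _ act.
have [D s aD] := active_slide act ij.
have [E CE Et] := alone_moves aC; have [F DF Fu] := alone_moves aD.
have [tx|tx] := eqVneq t x; last first.
  by case/eqP: Et; apply: frozen_connect fr CE _ _; rewrite !inE.
have CD := slide_connect s.
have frx G y : connect (puz 3) C G -> y != x -> G y = C y.
  by move=> CG yx; apply: frozen_connect fr CG _ _; rewrite !inE.
by case/eqP: Fu; rewrite (frx F) ?(frx D) ?(connect_trans CD) -?tx.
Qed.

End FacetMoves.

(** * Frozen tokens and symmetries *)

Section FrozenConfigurations.

Variable l : nat.
Implicit Types (C D E : config 4 l) (t u : label 4 l) (P : {set label 4 l}).

Lemma frozen_set1 P C D t :
    frozen P C -> ~: P \subset [set t] ->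
    connect (puz 3) C D -> D t = C t ->
  D = C.
Proof.
move=> fr Pt CD Dt; apply: config_eq => u.
have [uP|uP] := boolP (u \in P); first exact: frozen_connect fr CD _ uP.
have /set1P-> // : u \in [set t].
by apply: (subsetP Pt); rewrite inE.
Qed.

(** At most one token ever moves, so a path without repetition visits distinct ones among the 16
    vertices. *)
Lemma frozen_path P C D :
    frozen P C -> #|~: P| <= 1 -> connect (puz 3) C D ->
  exists p, [/\ path (puz 3) C p, last C p = D & size p <= 15].
Proof.
move=> fr P1 CD; have [P0|[t tP]] := set_0Vmem (~: P).
  exists [::]; split=> //=; apply: config_eq => t; apply/esym.
  by apply: frozen_connect fr CD _ _; rewrite -[P]setCK P0 !inE.
have Pt : ~: P \subset [set t].
  by apply/subsetP => u; rewrite (card_le1P P1 _ tP) !inE.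
have [p p_path ->] := connectP CD; case/shortenP: p_path => q q_path q_uniq _.
exists q; split=> //; suff : uniq [seq E t | E <- C :: q].
  move/card_uniqP; rewrite size_map /= => q_size.
  by rewrite -ltnS -q_size (leq_trans (max_card _)) // card_ffun card_bool card_ord.
rewrite map_inj_in_uniq // =>
  E F /(path_connect q_path) CE /(path_connect q_path) CF EF.
have FE : connect (puz 3) F E by rewrite (connect_trans _ CE) // connect_puz_sym.
exact: frozen_set1 (frozen_comp fr CF) Pt FE EF.
Qed.

Lemma frozen_not_mobile P C : frozen P C -> P != set0 -> ~~ mobile 3 C.
Proof.
move=> fr P0; rewrite negb_and !negbK -implyNb; apply/implyP.
rewrite /isolated negbK => /existsP[t /existsP[D tCD]].
have notP E F u : connect (puz 3) C E -> token_move 3 u E F -> u \notin P.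
  by move=> CE /token_moveP[i s _]; apply: frozen_slide (frozen_comp fr CE) s.
(* [P] witnesses semi-isolation; it is proper because the token [t] can move. *)
apply/existsP; exists P; apply/and3P; split=> //.
  by rewrite properE subsetT /=; apply/subsetPn; exists t; rewrite ?(notP C D).
apply/forall_inP => E; rewrite inE => /connectP[p p_path ->].
elim/last_ind: p p_path => [|p F IHp] //.
rewrite rcons_path last_rcons => /andP[p_path /puzP[u [i [s uF]]]].
apply: connect_trans (IHp p_path) (connect1 _); apply/exists_inP; exists u.
  rewrite inE (notP (last C p) F) //; first by apply/connectP; exists p.
  by apply/token_moveP; exists i.
by apply/token_moveP; exists i.
Qed.

(** In an active configuration all tokens but [t] and [u] lie on the square opposite to both in the
    coordinates [i] and [j]. Six tokens leave at least four there, and these are frozen. *)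
Lemma crowded_frozen C : l <= 10 -> exists2 P, frozen P C & P != set0.
Proof.
move=> l10; have n6 : 5 < #|label 4 l|.
  by rewrite card_ord -[2 ^ 4]/16 ltn_subRL (leq_ltn_trans (leq_add l10 (leqnn 5))).
have [[P fr P1]|[t [i [u [j act]]]]] := frozen_or_active C.
  exists P => //; rewrite -card_gt0 -(ltn_add2r #|~: P|) cardsC.
  by rewrite add0n (leq_ltn_trans P1) // (leq_trans _ n6).
have ij := active_coord act (leq_trans _ n6); case/activeP: act => ut aC Hu.
have P4 : 3 < #|~: [set t; u]|.
  by rewrite -(ltn_add2l #|[set t; u]|) cardsC cards2 eq_sym ut.
exists (~: [set t; u]); last by rewrite -card_gt0 (leq_trans _ P4).
apply: (@square_frozen _ _ _ i j (~~ C t i) (~~ C u j)) => //; first exact: ij.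
  by move=> x; rewrite !inE negb_or => /andP[xt _]; apply: (aloneP _ _ _ aC).
by move=> x; rewrite !inE negb_or => /andP[xt xu]; apply: Hu.
Qed.

(** * Relabellings of the tokens and symmetries of the cube *)

Definition relabel (g : {perm label 4 l}) C : config 4 l.
Proof.
apply: (@Config _ _ [ffun t => C (g t)]).
by apply/injectiveP => t u; rewrite !ffunE => /config_inj/perm_inj.
Defined.

Lemma relabelE g C t : relabel g C t = C (g t).
Proof. by rewrite ffunE. Qed.

Lemma permutedP g C D : reflect (D = relabel g C) (permuted g C D).
Proof.
apply: (iffP forallP) => [H|-> t]; last by rewrite relabelE.
by apply: config_eq => t; rewrite relabelE; apply/eqP.
Qed.

Lemma relabelM g h C : relabel g (relabel h C) = relabel (g * h)%g C.
Proof. by apply: config_eq => t; rewrite !relabelE permM. Qed.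

Lemma relabel1 C : relabel 1%g C = C.
Proof. by apply: config_eq => t; rewrite relabelE perm1. Qed.

Lemma even_perm_moving t : 2 < #|label 4 l| ->
  exists2 g : {perm label 4 l}, ~~ odd_perm g & g t != t.
Proof.
move=> n3; have [u] : exists u, u \in ~: [set t].
  by apply/card_gt0P; rewrite cardsC1 -ltnS (ltn_predK n3) ltnW.
rewrite !inE => ut; have [v] : exists v, v \in ~: [set t; u].
  apply/card_gt0P; rewrite -(ltn_add2l #|[set t; u]|) cardsC cards2 eq_sym ut.
  by rewrite addn0.
(* The product is a 3-cycle sending [t] to [u]. *)
rewrite !inE negb_or => /andP[vt vu]; exists (tperm t u * tperm t v)%g.
  by rewrite odd_mul_tperm odd_tperm eq_sym ut eq_sym vt.
by rewrite permM tpermL tpermD // eq_sym.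
Qed.

Lemma frozen_not_even_connected P C : frozen P C -> P != set0 -> 2 < #|label 4 l| ->
  exists2 g : {perm label 4 l}, ~~ odd_perm g & ~~ connect (puz 3) C (relabel g C).
Proof.
move=> fr /set0Pn[t tP] /(even_perm_moving t)[g g_even gt]; exists g => //.
apply: contra gt => /(frozen_connect fr)/(_ t tP).
by rewrite relabelE => /config_inj->.
Qed.

Lemma slide_relabel g t i C D :
  slide t i (relabel g C) (relabel g D) = slide (g t) i C D.
Proof.
apply/slideP/slideP; rewrite !relabelE => -[/aloneP aC Dt H]; split=> //.
- by apply/aloneP => u; have := aC (g^-1%g u);
  rewrite !relabelE permKV -(inj_eq (@perm_inj _ g)) permKV.
- by move=> u; have := H (g^-1%g u);
  rewrite !relabelE permKV -(inj_eq (@perm_inj _ g)) permKV.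
- by apply/aloneP => u ut; rewrite !relabelE; apply: aC; rewrite (inj_eq perm_inj).
by move=> u ut; rewrite !relabelE; apply: H; rewrite (inj_eq perm_inj).
Qed.

Lemma puz_relabel g C D : puz 3 (relabel g C) (relabel g D) = puz 3 C D.
Proof.
apply/puzP/puzP => -[t [i]].
  by rewrite slide_relabel !relabelE; exists (g t), i.
move=> tCD; exists (g^-1%g t), i.
by rewrite slide_relabel !relabelE permKV.
Qed.

(** These maps form the hyperoctahedral group, the automorphism group of the cube. *)
Definition cube_sym (s : 'S_4) (a : vertex 4) (v : vertex 4) : vertex 4 :=
  [ffun i => v (s i) (+) a i].

Lemma cube_symE s a v i : cube_sym s a v i = v (s i) (+) a i.
Proof. by rewrite ffunE. Qed.

Lemma cube_sym_inj s a : injective (cube_sym s a).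
Proof.
move=> v w /ffunP E; apply/ffunP => i; have := E (s^-1%g i).
by rewrite !cube_symE permKV => /addIb.
Qed.

Definition push (s : 'S_4) (a : vertex 4) C : config 4 l.
Proof.
apply: (@Config _ _ [ffun t => cube_sym s a (C t)]).
by apply/injectiveP => t u; rewrite !ffunE => /cube_sym_inj/config_inj.
Defined.

Lemma pushE s a C t : push s a C t = cube_sym s a (C t).
Proof. by rewrite ffunE. Qed.

Lemma push_inj s a : injective (push s a).
Proof.
move=> C D E; apply: config_eq => t; apply: (@cube_sym_inj s a).
by rewrite -!pushE E.
Qed.

Lemma alone_push s a t i C : alone (push s a C) t i = alone C t (s i).
Proof.
by apply: eq_forallb => u; rewrite !pushE !cube_symE (inj_eq (@addIb _)).
Qed.

Lemma slide_push s a t i C D :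
  slide t i (push s a C) (push s a D) = slide t (s i) C D.
Proof.
rewrite /slide alone_push !pushE !cube_symE (inj_eq (@addIb _));
  do 2!congr (_ && _).
by apply: eq_forallb => u; rewrite !pushE (inj_eq (@cube_sym_inj s a)).
Qed.

Lemma puz_push s a C D : puz 3 (push s a C) (push s a D) = puz 3 C D.
Proof.
apply/puzP/puzP => -[t [i tCD]].
  exists t, (s i); move: tCD.
  by rewrite slide_push !pushE (inj_eq (@cube_sym_inj s a)).
exists t, (s^-1%g i).
by rewrite slide_push permKV !pushE (inj_eq (@cube_sym_inj s a)).
Qed.

Lemma push_relabel s a g C : push s a (relabel g C) = relabel g (push s a C).
Proof. by apply: config_eq => t; rewrite !(pushE, relabelE). Qed.

End FrozenConfigurations.

(** * Cliques of configurations of five tokens *)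

Definition quad := (bool * bool * bool * bool)%type.

Definition coord (q : quad) (i : nat) : bool :=
  let: (a, b, c, d) := q in
  match i with 0 => a | 1 => b | 2 => c | _ => d end.

Definition quads : seq quad :=
  [seq (abc, d) | abc <- [seq (ab, c) | ab <- [seq (a, b) |
     a <- [:: false; true], b <- [:: false; true]], c <- [:: false; true]],
     d <- [:: false; true]].

(* (i, b, t, s) stands for the eight configurations in which the token t is the
   only one in the facet x_i = b, the other tokens being placed according to s,
   where the entry of t is None. *)
Definition clique := (nat * bool * nat * seq (option quad))%type.

Definition quad_key (o : option quad) (k : seq bool) : seq bool :=
  if o is Some (a, b, c, d) then [:: false, a, b, c, d & k] else true :: k.

(** Prefix coding: numbers are in unary with a closing [false], and a tag bit tells [None] from a
    vertex. Hence [key] is injective. *)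
Definition key (x : clique) : seq bool :=
  let: (i, b, t, s) := x in
  nseq i true ++ [:: false, b & nseq t true ++ false :: foldr quad_key [::] s].

Definition side (s : seq (option quad)) (u j : nat) : bool :=
  oapp (coord^~ j) false (nth None s u).

(** Entries [None] are ignored, so the same test serves whole configurations and cliques, where the
    free token is missing. *)
Definition lone (s : seq (option quad)) (u j : nat) : bool :=
  isSome (nth None s u) &&
  all (oapp (fun q => side s u j (+) coord q j) true) (set_nth None s u None).

Definition token_coords : seq (nat * nat) :=
  [seq (u, j) | u <- iota 0 5, j <- iota 0 4].

(** The token [t] is fixed at a vertex [w] of its facet outside the facet of another token, which
    thereby becomes the free one. The old and the new clique share the configuration so obtained. *)
Definition nbrs (x : clique) : seq clique :=
  let: (i, b, t, s) := x in
  [seq (p.2, side s p.1 p.2, p.1,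
        set_nth None (set_nth None s p.1 None) t (Some w))
    | p <- [seq p <- token_coords | lone s p.1 p.2],
      w <- [seq w <- quads |
             ~~ (b (+) coord w i) && (side s p.1 p.2 (+) coord w p.2)]].

Definition clique_of (s : seq (option quad)) (p : nat * nat) : clique :=
  (p.2, side s p.1 p.2, p.1, set_nth None s p.1 None).

Definition found (tr : trie) (s : seq (option quad)) : bool :=
  has (fun p => lone s p.1 p.2 && tmem (key (clique_of s p)) tr) token_coords.

(* The token 0, at p, is the free one; the tokens 2, 3, 4 occupy the square
   x_2 = x_3 = 0 except for its vertex (1, 1, 0, 0). *)
Definition apex (p q : quad) : seq quad :=
  [:: p; q; (false, false, false, false);
      (true, false, false, false); (false, true, false, false)].

(** [(b, c)] is the foot of the token 1 on the square: opposite to the gap, next to it, or the gap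
    itself. The feet [(0, 1)] and [(1, 0)] are equivalent up to symmetry and labels. *)
Definition start (b c : bool) : clique :=
  (3, true, 0,
   None :: map some (behead (apex (false, false, false, true) (b, c, true,
     false)))).

Definition quad_sym (s : seq nat) (a q : quad) : quad :=
  (coord q (nth 0 s 0) (+) coord a 0, coord q (nth 0 s 1) (+) coord a 1,
   coord q (nth 0 s 2) (+) coord a 2, coord q (nth 0 s 3) (+) coord a 3).

Definition select (g : seq nat) (s : seq (option quad)) :=
  [seq nth None s k | k <- g].

Definition transpose (x y k : nat) : nat :=
  if k == x then y else if k == y then x else k.

Definition swap01 := map (transpose 0 1) (iota 0 5).

Definition origin : seq (option quad) := 
  map some (apex (false, false, false, true) (false, false, true, false)).

(** The two tests on [start] show that all three shapes occur in one component; the tests on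
    symmetries and transpositions determine how the component is moved. *)
Definition certificate (frtr : seq clique * trie) : bool :=
  let: tr := frtr.2 in
  [&& saturated nbrs key frtr, ~~ found tr (select swap01 origin),
      tmem (key (start true false)) tr, tmem (key (start true true)) tr,
      all (fun s => all (fun a =>
        let r := map (omap (quad_sym s a)) origin in
        found tr r || found tr (select swap01 r)) quads) (permutations (iota 0 4))
    & all (fun x => all (fun y => (x == y) ||
        found tr (select (map (transpose 0 1 \o transpose x y) (iota 0 5)) origin))
        (iota 0 5)) (iota 0 5)].

Lemma certificate_ok : certificate (search nbrs key 16 (start false false)).
Proof. by vm_compute. Qed.

Lemma saturated10 : saturated nbrs key (search nbrs key 16 (start true false)).
Proof. by vm_compute. Qed.

Lemma saturated11 : saturated nbrs key (search nbrs key 16 (start true true)).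
Proof. by vm_compute. Qed.

Lemma nseq_false_inj m n k k' :
  nseq m true ++ false :: k = nseq n true ++ false :: k' -> m = n /\ k = k'.
Proof.
elim: m n => [|m IHm] [|n] //=; first by case.
by case=> /IHm[-> ->].
Qed.

Lemma quad_key_inj o o' k k' : quad_key o k = quad_key o' k' -> o = o' /\ k = k'.
Proof.
by case: o o' => [[[[a b] c] d]|] [[[[a' b'] c'] d']|] //= [] => [-> -> -> ->|] ->.
Qed.

Lemma key_inj : injective key.
Proof.
move=> [[[i b] t] s] [[[i' b'] t'] s'] /nseq_false_inj[-> [-> /nseq_false_inj[->
  E]]].
congr (_, _); elim: s s' E => [|o s IHs] [|o' s'] //=.
- by case: o' => [[[[a c] d] e]|].
- by case: o => [[[[a c] d] e]|].
by case/quad_key_inj => -> /IHs->.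
Qed.

Lemma mem_quads q : q \in quads.
Proof. by case: q => [[[[] []] []] []]. Qed.

Definition quad_of (v : vertex 4) : quad :=
  (v (@Ordinal 4 0 isT), v (@Ordinal 4 1 isT), v (@Ordinal 4 2 isT),
    v (@Ordinal 4 3 isT)).

Definition vertex_of (q : quad) : vertex 4 := [ffun i : 'I_4 => coord q i].

Lemma coord_quad_of v (i : 'I_4) : coord (quad_of v) i = v i.
Proof. by case: i => [[|[|[|[|]]]] ilt] //=; congr (v _); apply: val_inj. Qed.

Lemma quad_ofK : cancel quad_of vertex_of.
Proof. by move=> v; apply/ffunP => i; rewrite ffunE coord_quad_of. Qed.

Lemma vertex_ofK : cancel vertex_of quad_of.
Proof. by case=> [[[a b] c] d]; rewrite /quad_of !ffunE. Qed.

Lemma nbrsP i b t s y :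
  reflect (exists u j w, [/\ (u, j) \in token_coords, lone s u j, b = coord w i,
             coord w j = ~~ side s u j &
             y = (j, side s u j, u,
               set_nth None (set_nth None s u None) t (Some w))])
    (y \in nbrs (i, b, t, s)).
Proof.
apply: (iffP allpairsPdep) => [[[u j] [w []]]|[u [j [w [uj su bw sw ->]]]]].
  rewrite !mem_filter => /andP[su uj] /andP[/andP[bw sw] _] ->; exists u, j, w.
  split=> //; first by case: b bw; case: (coord w i).
  by case: (side s u j) sw; case: (coord w j).
exists (u, j), w; rewrite !mem_filter uj mem_quads; split=> //.
  by rewrite andbT.
by rewrite andbT bw addbb [coord w _]sw; case: (side s _ _).
Qed.

Arguments nbrs : simpl never.
Arguments coord : simpl never.
Arguments quad_of : simpl never.

(** * The graph of cliques as a model of the puzzle with five tokens *)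

Section FiveTokens.

Implicit Types (C D E : config 4 11) (t u x : label 4 11) (i j : 'I_4)
  (F G : label 4 11 -> option quad).

Lemma card_label : #|label 4 11| = 5.
Proof. by rewrite card_ord. Qed.

Lemma token_subproof n : n < 5 -> n < 2 ^ 4 - 11.
Proof. by []. Qed.

Definition token n (n5 : n < 5) : label 4 11 := Ordinal (token_subproof n5).

Definition tab F := [seq F t | t <- enum (label 4 11)].

Lemma size_tab F : size (tab F) = 5.
Proof. by rewrite size_map size_enum_ord. Qed.

Lemma nth_tab F t : nth None (tab F) t = F t.
Proof.
by rewrite (nth_map t) ?nth_ord_enum // size_enum_ord ltn_ord.
Qed.

Lemma tabE (s : seq (option quad)) F : size s = 5 ->
  (forall t, nth None s t = F t) -> s = tab F.
Proof.
move=> s5 sF; apply: (@eq_from_nth _ None) => [|n]; rewrite s5 ?size_tab // => n5.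
by rewrite (sF (token n5)) -nth_tab.
Qed.

Lemma eq_tab F G : F =1 G -> tab F = tab G.
Proof. by move=> FG; apply: eq_map. Qed.

Lemma set_nth_tab F t o : set_nth None (tab F) t o = tab [eta F with t |-> o].
Proof.
apply: tabE => [|x]; last by rewrite nth_set_nth /= nth_tab.
by rewrite size_set_nth size_tab; apply/maxn_idPr; apply: (ltn_ord t).
Qed.

Lemma all_tab (p : pred (option quad)) F : all p (tab F) = [forall t, p (F t)].
Proof.
by rewrite all_map; apply/allP/forallP => H t; have := H t;
  rewrite /= ?mem_enum //; apply.
Qed.

Lemma lone_tab F t j :
  lone (tab F) t j = isSome (F t) && [forall x, (x != t) ==>
    oapp (fun q => oapp (coord^~ j) false (F t) (+) coord q j) true (F x)].
Proof.
rewrite /lone /side nth_tab set_nth_tab all_tab; congr (_ && _).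
by apply: eq_forallb => x /=; case: eqP.
Qed.

Definition rows C := tab (fun t => Some (quad_of (C t))).

Definition others C t := tab (fun x =>
  if x == t then None else Some (quad_of (C x))).

Definition clq C t i : clique := (i : nat, C t i, t : nat, others C t).

Lemma nth_rows C t : nth None (rows C) t = Some (quad_of (C t)).
Proof. exact: nth_tab. Qed.

Lemma othersE C t : set_nth None (rows C) t None = others C t.
Proof. by rewrite set_nth_tab; apply: eq_tab. Qed.

Lemma lone_rows C t i : lone (rows C) t i = alone C t i.
Proof.
rewrite lone_tab; apply: eq_forallb => x /=.
by rewrite !coord_quad_of; case: (C x i); case: (C t i).
Qed.

Lemma side_rows C t i : side (rows C) t i = C t i.
Proof. by rewrite /side nth_rows /= coord_quad_of. Qed.

Lemma clique_of_rows C t i : clique_of (rows C) (t : nat, i : nat) = clq C t i.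
Proof. by rewrite /clique_of /= side_rows othersE. Qed.

(** Once [t] is removed, being alone is the last condition of [active]; so the steps out of a clique
    correspond to active configurations. *)
Lemma lone_others C t i u j : alone C t i ->
  lone (others C t) u j = active t i u j C.
Proof.
rewrite lone_tab /active => ->; case: eqVneq => //= ut.
apply: eq_forallb => x; case: (eqVneq x u) => /= xu; first by rewrite andbF.
by rewrite andbT; case: eqVneq => //= xt; rewrite !coord_quad_of; case: (C x j);
  case: (C u j).
Qed.

Lemma side_others C t u j : u != t -> side (others C t) u j = C u j.
Proof. by move=> /negPf ut; rewrite /side nth_tab ut /= coord_quad_of. Qed.

Lemma token_coordsP p :
  reflect (exists t i, p = (t : nat, i : nat)) (p \in token_coords).
Proof.
apply: (iffP allpairsP) => [[[n m] []]|[t [i ->]]].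
  rewrite !mem_iota => n5 m4 ->; exists (token n5), (Ordinal m4).
  by [].
exists (t : nat, i : nat); rewrite !mem_iota; split=> //.
  exact: (ltn_ord t).
exact: (ltn_ord i).
Qed.

Lemma others_slide C D t i u : slide t i C D -> u != t ->
  set_nth None (set_nth None (others C t) u None) t (Some (quad_of (D t))) =
  others D u.
Proof.
case/slideP => _ _ H ut; rewrite !set_nth_tab; apply: eq_tab => x /=.
case: eqVneq => [->|xt]; first by rewrite eq_sym (negPf ut).
by case: eqVneq => // xu; rewrite H.
Qed.

(** [D] is the configuration shared by the two cliques: [t] placed at the vertex [w] of the step.
    The converse is [clq_nbrs]. *)
Lemma nbrs_clq C t i y : alone C t i -> y \in nbrs (clq C t i) ->
  exists D u j, [/\ slide t i C D, alone D u j & y = clq D u j].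
Proof.
move=> aC /nbrsP[_ [_ [w [/token_coordsP[u [j [-> ->]]]]]]].
rewrite (lone_others _ _ aC) => act; have [ut _ Hu] := activeP _ _ _ _ _ act.
rewrite side_others // => wi wj ->.
have [D s Dt] : exists2 D, slide t i C D & D t = vertex_of w.
  by apply: moveE => //; rewrite ffunE.
have Dw : w = quad_of (D t) by rewrite Dt vertex_ofK.
have Du : D u = C u by case/slideP: s => _ _; apply.
exists D, u, j; split=> //; last by rewrite /clq /= Dw (others_slide s) ?Du.
apply/aloneP => x xu; rewrite Du; have [->|xt] := eqVneq x t.
  by rewrite Dt ffunE.
by case/slideP: s => _ _ H; rewrite H // Hu.
Qed.

Lemma clq_nbrs C D t i u j : slide t i C D -> u != t -> alone D u j ->
  clq D u j \in nbrs (clq C t i).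
Proof.
move=> s ut /aloneP aD; have [aC Dt H] := slideP _ _ _ _ s.
apply/nbrsP; exists (u : nat), (j : nat), (quad_of (D t)).
rewrite side_others // (lone_others _ _ aC) !coord_quad_of -(H u) // aD 1?eq_sym //.
split=> //; first by apply/token_coordsP; exists u, j.
  apply/activeP; split=> // x xt xu.
  by rewrite -(H x) // -(H u) // aD.
by rewrite /clq (others_slide s).
Qed.

(** Each step between cliques costs at most one move, to the shared configuration; one more move
    reaches [D] inside the last clique. *)
Lemma clique_path C D t i u j p : alone C t i -> alone D u j ->
    path (fun c d => d \in nbrs c) (clq C t i) p ->
      last (clq C t i) p = clq D u j ->
  exists q, [/\ path (puz 3) C q, last C q = D & size q <= (size p).+1].
Proof.
move=> aC aD; elim: p C t i aC => [|y p IHp] C t i aC /=.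
  move=> _ [/val_inj ij CD /val_inj ut E]; rewrite -ij -ut in aD CD E.
  have : slide t i C D.
    apply/slideP; split=> // x /negPf xt.
    have := nth_tab (fun x => if x == t then None else Some (quad_of (C x))) x.
    rewrite -/(others C t) E nth_tab xt => /Some_inj E'.
    exact: (can_inj quad_ofK).
  case/slide_puz => [->|CD1]; first by exists [::].
  by exists [:: D]; split=> //=; rewrite CD1.
case/andP=> /(nbrs_clq aC)[E [v [k [s aE ->]]]] p_path p_last.
have [q [q_path q_last q_size]] := IHp E v k aE p_path p_last.
case/slide_puz: s => [->|CE]; first by exists q; split=> //; apply: leqW.
by exists (E :: q); split=> //=; rewrite CE.
Qed.

(** If [t] is alone in two directions, the four other tokens fill a square, which is frozen. *)
Lemma alone_coord_inj C t i j : alone C t i -> alone C t j ->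
  ~~ frozen (~: [set t]) C -> i = j.
Proof.
move=> ai aj; apply: contraNeq => ij.
apply: (@square_frozen _ _ _ i j (~~ C t i) (~~ C t j)) => //.
- by rewrite cardsC1 card_label.
- by move=> x; rewrite !inE => /(aloneP _ _ _ ai).
by move=> x; rewrite !inE => /(aloneP _ _ _ aj).
Qed.

Lemma connect_last C D : connect (puz 3) C D ->
  C = D \/ exists u j, alone D u j.
Proof.
case/connectP => p + ->; elim/last_ind: p => [|p E _]; first by left.
rewrite rcons_path last_rcons => /andP[_ /puzP[u [j [s _]]]].
by right; exists u, j; apply: alone_slide s.
Qed.

(** A move stays inside a clique of the moved token, so only changes of clique at a fixed
    configuration matter. Distinct tokens give neighbouring cliques, and by [alone_coord_inj] a
    token has only one clique. *)
Lemma connect_clq (S : pred clique) C t i u j :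
    (forall c d, S c -> d \in nbrs c -> S d) ->
    active t i u j C -> S (clq C t i) ->
  forall D v k, connect (puz 3) C D -> alone D v k -> S (clq D v k).
Proof.
move=> S_closed act S_C D v k /connectP[p p_path ->].
have ij : i != j by apply: active_coord act _; rewrite card_label.
have [_ aC _] := activeP _ _ _ _ _ act.
have nfr E x : connect (puz 3) C E -> ~~ frozen (~: [set x]) E.
  move=> CE; apply: contra (active_not_frozen x act ij) => fr.
  by apply: frozen_comp fr _; rewrite connect_puz_sym.
have all_lone E x m : connect (puz 3) C E -> alone E x m -> S (clq E x m) ->
    forall y n, alone E y n -> S (clq E y n).
  move=> CE aE S_E y n ay; have [yx|yx] := eqVneq y x.
    by rewrite yx in ay *; rewrite -(alone_coord_inj aE ay (nfr E x CE)).
  by apply: S_closed S_E _; apply: clq_nbrs ay => //; apply: slide_refl.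
suff [x [m [ax S_x]]] : exists x m, alone (last C p) x m /\ S (clq (last C p) x m).
  by apply: all_lone ax S_x _ _; apply/connectP; exists p.
elim/last_ind: p p_path {v k} => [|p E IHp] /=; first by exists t, i.
rewrite rcons_path last_rcons => /andP[p_path /puzP[y [n [s _]]]].
have [x [m [ax S_x]]] := IHp p_path; exists y, n; split; first exact: alone_slide s.
have [ay Ey H] := slideP _ _ _ _ s.
have -> : clq E y n = clq (last C p) y n.
  by rewrite /clq Ey; congr (_, _); apply: eq_tab => z; case: eqVneq => // /H->.
by apply: all_lone ax S_x _ _ ay; apply/connectP; exists p.
Qed.

End FiveTokens.

(** * Search results read as statements about components *)

Section Components.

Implicit Types (C D E : config 4 11) (t u x y : label 4 11) (i j : 'I_4)
  (g h : {perm label 4 11}).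

Lemma search_path n C t i u j D : active t i u j C ->
    saturated nbrs key (search nbrs key n (clq C t i)) -> connect (puz 3) C D ->
  exists p, [/\ path (puz 3) C p, last C p = D & size p <= n.+1].
Proof.
move=> act sat CD; have [sound mem closed] := searchP nbrs key_inj n (clq C t i).
case: (connect_last CD) => [->|[v [k aD]]]; first by exists [::].
have tr_D := connect_clq (S := fun c =>
  tmem (key c) (search nbrs key n (clq C t i)).2)
  (closed sat) act mem CD aD.
have [p [p_path p_last p_size]] := sound _ tr_D.
have [_ aC _] := activeP _ _ _ _ _ act.
have [q [q_path q_last q_size]] := clique_path aC aD p_path p_last.
by exists q; split=> //; apply: leq_trans q_size _.
Qed.

Lemma foundP tr D :
  reflect (exists u j, alone D u j /\ tmem (key (clq D u j)) tr) (found tr (rows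
    D)).
Proof.
apply: (iffP hasP) => [[p /token_coordsP[u [j ->]] /andP[]]|[u [j [aD tr_D]]]].
  by rewrite lone_rows clique_of_rows => aD tr_D; exists u, j.
exists (u : nat, j : nat); first by apply/token_coordsP; exists u, j.
by rewrite lone_rows aD clique_of_rows.
Qed.

(** Connectivity becomes a lookup: paths of cliques lift to paths of moves, and a saturated trie
    contains every clique met by the component. *)
Lemma foundE n C t i u j D : active t i u j C ->
    saturated nbrs key (search nbrs key n (clq C t i)) ->
  found (search nbrs key n (clq C t i)).2 (rows D) = connect (puz 3) C D.
Proof.
move=> act sat; have [sound mem closed] := searchP nbrs key_inj n (clq C t i).
have [_ aC _] := activeP _ _ _ _ _ act.
apply/foundP/idP => [[v [k [aD /sound[p [p_path p_last _]]]]]|CD].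
  have [q [q_path <- _]] := clique_path aC aD p_path p_last.
  by apply/connectP; exists q.
have [v [k aD]] : exists v k, alone D v k.
  by case: (connect_last CD) => [<-|//]; exists t, i.
exists v, k; split=> //.
exact: (connect_clq (S := fun c => tmem (key c) (search nbrs key n (clq C t i)).2)
  (closed sat) act mem CD aD).
Qed.

Definition free_token := @token 0 isT.
Definition apex_token := @token 1 isT.
Definition axis2 : 'I_4 := @Ordinal 4 2 isT.
Definition axis3 : 'I_4 := @Ordinal 4 3 isT.

Lemma apexP C p b c : rows C = map some (apex p (b, c, true, false)) -> coord p 3 ->
  active free_token axis3 apex_token axis2 C /\ clq C free_token axis3 = start b c.
Proof.
move=> CE p3; have aC : alone C free_token axis3.
  by rewrite -lone_rows CE; case: p p3 {CE} => [[[? ?] ?] []]; case: b; case: c.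
split.
  by rewrite -(lone_others _ _ aC) -othersE CE; case: b {CE}; case: c.
rewrite /clq -othersE -side_rows CE; congr (_, _, _, _).
by rewrite /side /= p3.
Qed.

Lemma rows_relabel g C :
  rows (relabel g C) = select [seq g t : nat | t <- enum (label 4 11)] (rows C).
Proof.
by rewrite /select -map_comp; apply: eq_map => t; rewrite /= nth_rows relabelE.
Qed.

Lemma rows_push s a C :
  rows (push s a C) =
  map (omap (quad_sym [seq s i : nat | i <- enum 'I_4] (quad_of a))) (rows C).
Proof.
have sE (i : 'I_4) : nth 0 [seq s i : nat | i <- enum 'I_4] i = s i.
  by rewrite (nth_map i) ?nth_ord_enum // size_enum_ord.
rewrite /rows /tab -map_comp; apply: eq_map => t; congr Some.
rewrite /quad_sym (sE (@Ordinal 4 0 isT)) (sE (@Ordinal 4 1 isT)).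
rewrite (sE (@Ordinal 4 2 isT)) (sE (@Ordinal 4 3 isT)) !coord_quad_of.
by rewrite /quad_of pushE !cube_symE.
Qed.

Lemma configP (L : seq quad) : size L = 5 -> uniq L ->
  exists C, rows C = map some L.
Proof.
move=> L5 uL; pose q0 := head (false, false, false, false) L.
have inj_f : injectiveb [ffun t : label 4 11 => vertex_of (nth q0 L t)].
  apply/injectiveP => t u; rewrite !ffunE => /(can_inj vertex_ofK)/eqP.
  by rewrite nth_uniq ?L5 ?(ltn_ord t) ?(ltn_ord u) // => /eqP/val_inj.
exists (Config inj_f); apply/esym/tabE => [|t]; first by rewrite size_map.
by rewrite (nth_map q0) ?L5 ?(ltn_ord t) //= ffunE vertex_ofK.
Qed.

Lemma transposeE x y t : tperm x y t = transpose x y t :> nat.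
Proof. by rewrite permE /= /transpose !(inj_eq val_inj); do 2!case: ifP => //. Qed.

Lemma enum_tokens : [seq (t : nat) | t <- enum (label 4 11)] = iota 0 5.
Proof. exact: val_enum_ord. Qed.

Definition swap : {perm label 4 11} := tperm free_token apex_token.

Lemma rows_swap C : rows (relabel swap C) = select swap01 (rows C).
Proof.
rewrite rows_relabel /swap01 -enum_tokens -map_comp.
by congr select; apply: eq_map => t; apply: transposeE.
Qed.

Section Base.

Variables (C0 : config 4 11).
Hypothesis C0_rows : rows C0 = origin.

Lemma apexC0 : active free_token axis3 apex_token axis2 C0 /\
  clq C0 free_token axis3 = start false false.
Proof. exact: apexP C0_rows _. Qed.

Lemma certificateP frtr : certificate frtr ->
    (forall D, found frtr.2 (rows D) = connect (puz 3) C0 D) ->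
  [/\ ~~ connect (puz 3) C0 (relabel swap C0),
      forall s a, connect (puz 3) C0 (push s a C0) ||
                  connect (puz 3) C0 (relabel swap (push s a C0))
    & forall x y, x != y -> connect (puz 3) C0 (relabel (tperm x y * swap)%g C0)].
Proof.
case/and5P=> _ nswap _ _ /andP[/allP cube /allP perm] foundE; split.
- by rewrite -foundE rows_swap C0_rows.
- move=> s a; rewrite -!foundE rows_swap rows_push C0_rows.
  apply: (allP (cube [seq s i : nat | i <- enum 'I_4] _)); last exact: mem_quads.
  (* The list of values of [s] is one of the permutations enumerated by the certificate. *)
  rewrite mem_permutations uniq_perm ?iota_uniq //.
    by rewrite map_inj_uniq ?enum_uniq // => i j /val_inj/perm_inj.
  move=> k; rewrite mem_iota; apply/mapP/idP => [[i _ ->]|k4]; first exact: ltn_ord.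
  by exists (s^-1%g (Ordinal k4)); rewrite ?mem_enum ?permKV.
move=> x y xy; rewrite -foundE rows_relabel C0_rows.
have x5 : (x : nat) \in iota 0 5 by rewrite mem_iota (ltn_ord x).
have y5 : (y : nat) \in iota 0 5 by rewrite mem_iota (ltn_ord y).
have /allP/(_ _ y5)/orP[/eqP/val_inj/eqP|] := perm _ x5;
  first by rewrite (negPf xy).
rewrite -enum_tokens -map_comp; congr (found _ (select _ _)).
by apply: eq_map => t; rewrite /= permM !transposeE.
Qed.

Lemma certificate_saturated frtr : certificate frtr ->
  [/\ saturated nbrs key frtr, tmem (key (start true false)) frtr.2
    & tmem (key (start true true)) frtr.2].
Proof. by case/and5P. Qed.

Lemma C0_saturated : saturated nbrs key (search nbrs key 16 (clq C0 free_token
  axis3)).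
Proof.
by have [_ ->] := apexC0; case: (certificate_saturated certificate_ok).
Qed.

Lemma C0_facts :
  [/\ ~~ connect (puz 3) C0 (relabel swap C0),
      forall s a, connect (puz 3) C0 (push s a C0) ||
                  connect (puz 3) C0 (relabel swap (push s a C0))
    & forall x y, x != y -> connect (puz 3) C0 (relabel (tperm x y * swap)%g C0)].
Proof.
have [act clqE] := apexC0; apply: certificateP certificate_ok _ => D.
by rewrite -clqE; apply: foundE act C0_saturated.
Qed.

Lemma apex_connect C p b c : rows C = map some (apex p (b, c, true, false)) ->
  coord p 3 -> c ==> b -> connect (puz 3) C0 C.
Proof.
move=> CE p3 cb; have [act CR] := apexP CE p3; have [act0 clqE] := apexC0.
rewrite -(foundE _ act0 C0_saturated) clqE; apply/foundP.
have [_ aC _] := activeP _ _ _ _ _ act.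
exists free_token, axis3; split; first exact: aC.
have [_ tr10 tr11] := certificate_saturated certificate_ok.
have [_ tr00 _] := searchP nbrs key_inj 16 (start false false).
rewrite CR; move: tr00 tr10 tr11; move: (search _ _ _ _).2 => tr.
by case: b c cb {CE CR act} => [] [].
Qed.

End Base.

End Components.

(** * The two components of mobile configurations *)

Section MobileComponents.

Variables (C0 : config 4 11).
Hypothesis C0_rows : rows C0 = origin.

Implicit Types (C D E : config 4 11) (t u x y : label 4 11) (i j : 'I_4)
  (g h : {perm label 4 11}).

Local Notation "C ~~> D" := (connect (puz 3) C D) (at level 70).

Lemma connect_mono (f : config 4 11 -> config 4 11) C D :
  {mono f : C D / puz 3 C D} -> C ~~> D -> f C ~~> f D.
Proof.
move=> f_mono /connectP[p p_path ->]; apply/connectP; exists (map f p).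
  by rewrite path_map (eq_path (e' := puz 3)).
by rewrite last_map.
Qed.

Lemma connect_relabel g C D : C ~~> D -> relabel g C ~~> relabel g D.
Proof. by apply: connect_mono => E F; apply: puz_relabel. Qed.

Lemma connect_push s a C D : C ~~> D -> push s a C ~~> push s a D.
Proof. by apply: connect_mono => E F; apply: puz_push. Qed.

Lemma connectC C D : (C ~~> D) = (D ~~> C).
Proof. exact: connect_puz_sym. Qed.

(** By the next two lemmas these [g] are closed under products and inverses: they form the group of
    label permutations achievable from [C0]. *)
Definition linked g := C0 ~~> relabel g C0.

Lemma linkedM g h : linked g -> linked h -> linked (g * h)%g.
Proof.
move=> lg /(connect_relabel g); rewrite relabelM; exact: connect_trans lg.
Qed.

Lemma linkedV g : linked g -> linked g^-1%g.
Proof.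
by move/(connect_relabel g^-1%g); rewrite relabelM mulVg relabel1 connectC.
Qed.

Lemma swapK : (swap * swap = 1)%g.
Proof. exact: tperm2. Qed.

Lemma odd_swap : odd_perm swap.
Proof. by rewrite odd_tperm. Qed.

(** Write [g] as a product of transpositions [(x y)]; each [(x y)(0 1)] is linked, and the copies of
    [swap] cancel in pairs. *)
Lemma linked_swap g : linked (g * swap ^+ odd_perm g)%g.
Proof.
have [_ _ link] := C0_facts C0_rows.
have [ts -> ts_ok] := prod_tpermP g.
elim/last_ind: ts ts_ok => [_|ts [x y] IHts].
  by rewrite big_nil odd_perm1 mulg1 /linked relabel1 connect0.
rewrite all_rcons -cats1 big_cat big_seq1 /= => /andP[xy /IHts {}IHts].
rewrite odd_permM odd_tperm xy addbT; case: odd_perm IHts;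
  rewrite !(expg0, expg1, mulg1) => lts.
  (* After an odd prefix, the inverse [(0 1)(x y)] is appended, and its [swap] cancels the pending
     one. *)
  have /linkedV := link x y xy; rewrite invMg tpermV tpermV => /(linkedM lts).
  by rewrite mulgA -(mulgA _ swap swap) swapK mulg1.
by rewrite -mulgA; apply: linkedM lts (link x y xy).
Qed.

Lemma linked_even g : ~~ odd_perm g -> linked g.
Proof. by move/negPf=> g_even; have := linked_swap g; rewrite g_even mulg1. Qed.

(** The union of two components, which [mobile_sheet] identifies with the set of mobile
    configurations. *)
Definition sheet C := (C0 ~~> C) || (relabel swap C0 ~~> C).

Lemma sheetP C :
  reflect (exists b : bool, relabel (swap ^+ b)%g C0 ~~> C) (sheet C).
Proof.
apply: (iffP orP) => [[]|[[] CD]]; first by exists false; rewrite // expg0 relabel1.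
- by exists true; rewrite // expg1.
- by right; rewrite expg1 in CD.
by left; rewrite expg0 relabel1 in CD.
Qed.

Lemma linked_same_parity g h : odd_perm g = odd_perm h ->
  relabel g C0 ~~> relabel h C0.
Proof.
move=> gh; have : linked (g^-1 * h)%g.
  by apply: linked_even; rewrite odd_permM odd_permV gh addbb.
by move/(connect_relabel g); rewrite relabelM mulgA mulgV mul1g.
Qed.

Lemma odd_swapX (b : bool) : odd_perm (swap ^+ b)%g = b.
Proof. by case: b; rewrite ?expg1 ?odd_swap // expg0 odd_perm1. Qed.

Lemma sheet_relabel g C : sheet C -> sheet (relabel g C).
Proof.
case/sheetP => b /(connect_relabel g); rewrite relabelM => CD.
apply/sheetP; exists (odd_perm g (+) b); apply: connect_trans CD.
by apply: linked_same_parity; rewrite odd_swapX odd_permM odd_swapX.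
Qed.

Lemma even_relabel_connect g C : sheet C -> ~~ odd_perm g -> C ~~> relabel g C.
Proof.
case/sheetP => b CD /negPf g_even; have := connect_relabel g CD; rewrite relabelM.
apply: connect_trans; rewrite connectC in CD; apply: connect_trans CD _.
by apply: linked_same_parity; rewrite odd_permM g_even.
Qed.

Lemma sheet_connect C D : sheet C -> C ~~> D -> sheet D.
Proof.
by move=> /orP[] CE CD; apply/orP; [left | right]; apply: connect_trans CE CD.
Qed.

Lemma sheet_push s a C : sheet C -> sheet (push s a C).
Proof.
have [_ cube _] := C0_facts C0_rows.
case/sheetP => b /(connect_push s a); rewrite push_relabel => /sheet_connect.
apply; apply: sheet_relabel; apply/orP; case/orP: (cube s a); first by left.
by move/(connect_relabel swap); rewrite relabelM swapK relabel1; right.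
Qed.

(** By finiteness, an injection of the sheet into itself is onto it, so no point outside is sent
    into it. *)
Lemma sheet_inj (f : config 4 11 -> config 4 11) C : injective f ->
  (forall D, sheet D -> sheet (f D)) -> sheet (f C) -> sheet C.
Proof.
move=> f_inj f_sheet fC; have : f @: finset sheet == finset sheet.
  rewrite eqEcard card_imset // leqnn andbT.
  by apply/subsetP => _ /imsetP[D + ->]; rewrite !inE => /f_sheet.
move/eqP/setP/(_ (f C)); rewrite (mem_imset _ _ f_inj) !inE.
by rewrite fC => ->.
Qed.

(** Even relabellings stay in the component, and any given token is displaced by one of them; hence
    no token is at rest throughout the component. *)
Lemma sheet_mobile C : sheet C -> mobile 3 C.
Proof.
move=> CS; have moving t : exists2 D, C ~~> D & D t != C t.
  have [|g g_even gt] := even_perm_moving t; first by rewrite card_label.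
  exists (relabel g C); first exact: even_relabel_connect.
  by rewrite relabelE (inj_eq (@config_inj _ C)).
apply/andP; split.
  rewrite negbK; have [D /connectP[[|E p]] /= ] := moving free_token.
    by move=> _ ->; rewrite eqxx.
  case/andP=> /puzP[t [i [s Et]]] _ _ _; apply/existsP; exists t.
  by apply/existsP; exists E; apply/token_moveP; exists i.
apply/negP => /existsP[A /and3P[/set0Pn[t tA] _ /forall_inP CA]].
have [D CD] := moving t; case/negP.
have {CD}/CA/connectP[p + ->] : D \in component 3 C by rewrite inE.
elim/last_ind: p => [|p E IHp] /=; first by rewrite eqxx.
rewrite rcons_path last_rcons => /andP[/IHp/eqP <- /exists_inP[u]].
rewrite inE => uA /token_moveP[i /slideP[_ _ H] _]; rewrite H //.
by apply: contraNneq uA => <-.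
Qed.

End MobileComponents.

(** * Normal form of active configurations *)

Section ActiveConfigurations.

Implicit Types (C D E : config 4 11) (t u x y : label 4 11) (i j k : 'I_4).

Lemma rows_of_index C (L : seq quad) : size L = 5 ->
  (forall x, quad_of (C x) \in L) -> exists g, rows (relabel g C) = map some L.
Proof.
move=> L5 CL; have index5 x : index (quad_of (C x)) L < 5.
  by have := CL x; rewrite -index_mem L5.
have pos_inj : injective (fun x => token (index5 x)).
  move=> x y /(congr1 val) /= xy; apply: (@config_inj _ C);
    apply: (can_inj quad_ofK).
  by rewrite -(nth_index (quad_of (C x)) (CL x)) xy nth_index.
(* Tokens are numbered by the position of their vertex in [L]; [relabel] looks labels up through
   [g], hence the inverse. *)
exists (perm pos_inj)^-1%g; apply/esym/tabE => [|y]; first by rewrite size_map.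
rewrite relabelE -{1}(permKV (perm pos_inj) y) permE /=.
set x := (_ y); rewrite (nth_map (quad_of (C x))) ?index_mem //.
by rewrite nth_index.
Qed.

(* (X, Y) is the vertex of the square x_i = ~~ C t i, x_j = ~~ C u j that no
   token occupies; it is sent to (1, 1, 0, 0). *)
Lemma normalize_axes C t i u j k k' (X Y : bool) :
    active t i u j C -> uniq [:: k; k'; j; i] ->
    (forall x, C x i = ~~ C t i -> C x j = ~~ C u j -> C x k = X -> C x k' != Y) ->
    (C u k' == Y) ==> (C u k == X) ->
  exists s a g p b c, [/\ c ==> b, coord p 3 &
    rows (relabel g (push s a C)) = map some (apex p (b, c, true, false))].
Proof.
case/activeP => ut /aloneP aC Hu axes free uXY.
have s_inj : injective (fun z : 'I_4 => nth i [:: k; k'; j; i] z).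
  by move=> z z' /eqP; rewrite nth_uniq ?(ltn_ord z) ?(ltn_ord z') // =>
    /eqP/val_inj.
(* In the axes [k], [k'], [j], [i], this reflection takes the vacancy to [(1, 1, 0, 0)], [u] to
   [x_2 = 1] and [t] to [x_3 = 1]. *)
pose a := vertex_of (~~ X, ~~ Y, ~~ C u j, ~~ C t i);
  pose D := push (perm s_inj) a C.
have DE x : quad_of (D x) = (C x k (+) ~~ X, C x k' (+) ~~ Y, C x j (+) ~~ C u j,
  C x i (+) ~~ C t i).
  by rewrite /quad_of pushE !cube_symE !permE /= !ffunE.
have DL x : quad_of (D x) \in
    apex (quad_of (D t)) (C u k (+) ~~ X, C u k' (+) ~~ Y, true, false).
  have [->|xt] := eqVneq x t; first by rewrite inE eqxx.
  rewrite !inE; apply/orP; right.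
  have [->|xu] := eqVneq x u;
    first by rewrite DE !addbN addbb (aC u ut) addNb addbb !negbK eqxx.
  have := free x; rewrite DE (aC x) // Hu // !addbb => /(_ erefl erefl).
  by case: (C x k) (C x k') X Y {D DE a uXY free} => [] [] [] [] //= H;
    rewrite ?orbT //; case/eqP: (H erefl).
have [//|g gE] := rows_of_index _ DL.
exists (perm s_inj), a, g, (quad_of (D t)), (C u k (+) ~~ X), (C u k' (+) ~~ Y).
split=> //; last by rewrite DE /coord addbN addbb.
by move: uXY; case: (C u k) (C u k') X Y {D DE DL a free g gE} => [] [] [] [].
Qed.

(** Only three tokens remain besides [t] and [u], too few for the four vertices of the square. *)
Lemma square_vacancy C t i u j k k' :
    active t i u j C ->
  exists X Y, forall x, C x i = ~~ C t i -> C x j = ~~ C u j -> C x k = X ->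
    C x k' != Y.
Proof.
case/activeP => ut /aloneP aC Hu.
pose hit (p : bool * bool) x :=
  [&& C x i == ~~ C t i, C x j == ~~ C u j, C x k == p.1 & C x k' == p.2].
have [/forallP full|/forallPn[[X Y]]] := boolP [forall p, [exists x, hit p x]];
  last first.
  rewrite negb_exists => /forallP free; exists X, Y => x xi xj xk.
  by have := free x; rewrite /hit /= xi xj xk !eqxx.
have {full} [h hP] := fin_all_exists (fun p => existsP (full p)).
have h_inj : injective h.
  move=> [a b] [a' b'] hh; have /and4P[_ _ /eqP ha /eqP hb] := hP (a, b).
  have /and4P[_ _ /eqP ha' /eqP hb'] := hP (a', b').
  by rewrite hh ha' in ha; rewrite hh hb' in hb; congr (_, _).
have : h @: setT \subset ~: [set t; u].
  apply/subsetP => _ /imsetP[p _ ->]; have /and4P[/eqP hi /eqP hj _ _] := hP p.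
  rewrite !inE negb_or; apply/andP; split.
    by apply/eqP => ht; move: hi; rewrite ht; case: (C t i).
  by apply/eqP => hu; move: hj; rewrite hu; case: (C u j).
move/subset_leq_card; rewrite card_imset // cardsT card_prod card_bool.
rewrite -(leq_add2l #|[set t; u]|) cardsC cards2 eq_sym ut.
by rewrite card_label.
Qed.

Lemma normalize C t i u j : active t i u j C ->
  exists s a g p b c, [/\ c ==> b, coord p 3 &
    rows (relabel g (push s a C)) = map some (apex p (b, c, true, false))].
Proof.
move=> act; have ij : i != j by apply: active_coord act _; rewrite card_label.
have /cards2P[k [k' [kk' kE]]] : #|~: [set i; j]| == 2.
  by rewrite -(eqn_add2l #|[set i; j]|) cardsC card_ord cards2 ij.
have := in_setC k [set i; j]; rewrite kE !inE eqxx negb_or => /esym/andP[ki kj].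
have := in_setC k' [set i; j];
  rewrite kE !inE eqxx orbT negb_or => /esym/andP[k'i k'j].
have axes : uniq [:: k; k'; j;
  i] by rewrite /= !inE !negb_or kk' kj ki k'j k'i eq_sym ij.
have axes' : uniq [:: k'; k; j;
  i] by rewrite /= !inE !negb_or eq_sym kk' kj ki k'j k'i eq_sym ij.
have [X [Y free]] := square_vacancy k k' act.
have [uXY|] := boolP ((C u k' == Y) ==> (C u k == X)).
  exact: normalize_axes act axes free uXY.
(* Here the foot of [u] agrees with the vacancy in [k'] only; exchanging [k] and [k'] restores the
   required implication. *)
rewrite negb_imply => /andP[uY uX].
apply: (@normalize_axes _ _ _ _ _ k' k Y X act axes'); last by rewrite uY implybT.
by move=> x xi xj /eqP xY; apply/negP => /eqP xX; have := free x xi xj xX;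
  rewrite xY.
Qed.

Variable C0 : config 4 11.
Hypothesis C0_rows : rows C0 = origin.

Lemma active_sheet C t i u j : active t i u j C -> sheet C0 C.
Proof.
case/normalize => s [a [g [p [b [c [cb p3 E]]]]]].
apply: (@sheet_inj _ (relabel g \o push s a)).
- by move=> D E' /(congr1 (relabel g^-1%g));
  rewrite /= !relabelM mulVg !relabel1 => /push_inj.
- by move=> D /(sheet_push C0_rows s a)/(sheet_relabel C0_rows g).
by apply/orP; left; apply: (apex_connect C0_rows E p3 cb).
Qed.

End ActiveConfigurations.

(** * The distance bound, the value of [minS 4 3] and strong parity *)

Lemma connect_path_mono (f : config 4 11 -> config 4 11) n C D :
    injective f -> {mono f : C D / puz 3 C D} ->
    (exists p, [/\ path (puz 3) (f C) p, last (f C) p = f D & size p <= n]) ->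
  exists p, [/\ path (puz 3) C p, last C p = D & size p <= n].
Proof.
move=> f_inj f_mono [p [p_path p_last p_size]]; exists (map (invF f_inj) p).
have pE : p = map f (map (invF f_inj) p).
  by rewrite -map_comp -[LHS]map_id; apply: eq_map => E /=; rewrite f_invF.
split; last by rewrite size_map.
  by move: p_path; rewrite {1}pE path_map (eq_path (e' := puz 3)).
by apply: (@f_inj _ _); rewrite -last_map -pE.
Qed.

Lemma start_saturated b c : c ==> b ->
  saturated nbrs key (search nbrs key 16 (start b c)).
Proof.
case: b; case: c => cb;
  [exact: saturated11 | exact: saturated10 | discriminate cb |].
by case: (certificate_saturated certificate_ok).
Qed.

(** The normalization is an automorphism of the puzzle graph, so the path can be sought from one of
    the three searched cliques: 16 steps between cliques and one final move. *)
Lemma active_path (C D : config 4 11) t i u j : active t i u j C ->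
  connect (puz 3) C D ->
  exists p, [/\ path (puz 3) C p, last C p = D & size p <= 17].
Proof.
move=> /normalize[s [a [g [p [b [c [cb p3 E]]]]]]] CD.
have f_mono : forall F G : config 4 11,
    puz 3 ((relabel g \o push s a) F) ((relabel g \o push s a) G) = puz 3 F G.
  by move=> F G; rewrite /= puz_relabel puz_push.
apply: (@connect_path_mono (relabel g \o push s a)) => //.
  by move=> F G /(congr1 (relabel g^-1%g));
    rewrite /= !relabelM mulVg !relabel1 => /push_inj.
have [act clqE] := apexP E p3; apply: (search_path act);
  last exact: connect_mono f_mono CD.
rewrite clqE; exact: start_saturated.
Qed.

Lemma distance17 (C D : config 4 11) : connect (puz 3) C D ->
  exists p : seq (config 4 11), [/\ path (puz 3) C p, last C p = D & size p <= 17].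
Proof.
case: (frozen_or_active C) => [[P fr P1] CD|[t [i [u [j act]]]]];
  last exact: active_path act.
have [p [p_path p_last p_size]] := frozen_path fr P1 CD.
by exists p; split=> //; apply: leq_trans p_size _.
Qed.

Lemma mobile_sheet (C0 C : config 4 11) : rows C0 = origin ->
  mobile 3 C = sheet C0 C.
Proof.
move=> C0_rows; apply/idP/idP; last exact: sheet_mobile.
case: (frozen_or_active C) => [[P fr P1]|[t [i [u [j act]]] _]].
  apply: contraTT => _; apply: frozen_not_mobile fr _.
  rewrite -card_gt0 -(ltn_add2r #|~: P|) cardsC card_label.
  exact: leq_ltn_trans P1 _.
exact: active_sheet act.
Qed.

Lemma exists_origin : exists C0, rows C0 = origin.
Proof. exact: configP. Qed.

Lemma minS43 : minS 4 3 = 11.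
Proof.
rewrite /minS; case: ex_minnP => m /andP[/andP[_ _]].
case/existsP=> C /forallP ev min; apply/eqP; rewrite eqn_leq; apply/andP; split.
  apply: min; apply/andP; split=> //; have [C0 C0_rows] := exists_origin.
  apply/existsP; exists C0; apply/forallP => g; apply/forallP => D.
  apply/implyP => g_even; apply/implyP => /permutedP ->.
  exact: linked_even C0_rows g g_even.
rewrite leqNgt ltnS; apply/negP => m10.
(* A frozen token is displaced by some even relabelling, which contradicts even solvability at
   [C]. *)
have [P fr P0] := crowded_frozen C m10.
have [|g g_even] := frozen_not_even_connected fr P0.
  by rewrite card_ord -[2 ^ 4]/16 ltn_subRL (leq_ltn_trans (leq_add m10 (leqnn 2))).
case/negP; have /forallP/(_ (relabel g C)) := ev g.
by rewrite g_even /= => /implyP; apply; apply/permutedP.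
Qed.

Lemma strong_parity43 : strong_parity 4 3 11.
Proof.
have [C0 C0_rows] := exists_origin; pose C1 := relabel swap C0.
have mem_component (C D : config 4 11) : (D \in component 3 C) = connect (puz 3)
  C D by rewrite inE.
have same_component (C D : config 4 11) : connect (puz 3) C D ->
  component 3 C = component 3 D.
  move=> CD; apply/setP => E; rewrite !mem_component.
  exact: (same_connect (@connect_puz_sym 11) CD).
rewrite /strong_parity; have [C0C1 _ _] := C0_facts C0_rows.
suff -> : [set K in components 4 3 11 | [exists C in K, mobile 3 C]] =
          [set component 3 C0; component 3 C1].
  rewrite cards2 (_ : component 3 C0 != component 3 C1) //.
  apply: contra C0C1 => /eqP K01.
  by rewrite -mem_component K01 mem_component connect0.
apply/setP => K; rewrite !inE; apply/andP/orP => [[/imsetP[C _ ->]]|].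
  case/exists_inP=> D; rewrite mem_component (mobile_sheet _ C0_rows) =>
    CD /orP[] KD; [left | right];
  by rewrite (same_component _ _ CD) (same_component _ _ KD).
have K_ok C : sheet C0 C -> component 3 C \in components 4 3 11 /\
    [exists D in component 3 C, mobile 3 D].
  move=> CS; split; first exact: imset_f.
  by apply/exists_inP; exists C;
    rewrite ?mem_component ?connect0 ?(mobile_sheet _ C0_rows).
by case=> /eqP->; apply: K_ok; rewrite /sheet connect0 ?orbT.
Qed.

Theorem theorem1p17 :
  [/\ minS 4 3 = 11,
      forall C D : config 4 11, connect (puz 3) C D ->
        exists p : seq (config 4 11),
          [/\ path (puz 3) C p, last C p = D & size p <= 17]
    & strong_parity 4 3 (minS 4 3)].
Proof. by rewrite minS43; split=> //;
  [exact: distance17 | exact: strong_parity43]. Qed.
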